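(* Let $k$ and $m$ be positive integers. Let $G$ be a $k$-connected graph with \[ \delta(G)\ge \max\{k+1,2m-2\}. \] Then $G$ contains a $k$-removable matching of size $m$, unless $G\cong K_{2m-1}$, or $(k,m)=(1,2)$ and $G$ is a cycle.
   Context: All graphs are finite, undirected and simple. $\delta(G)$ is the minimum degree of $G$. A graph is $k$-connected in the usual sense: it has more than $k$ vertices and deleting any set of fewer than $k$ vertices leaves a connected graph. For a $k$-connected graph $G$, a matching $M\subseteq E(G)$ (a set of pairwise vertex-disjoint edges) is called $k$-removable if the graph $G-M$, obtained from $G$ by deleting the edges in $M$ (keeping all vertices), is $k$-connected. The size of a matching is its number of edges. *)

(* Defs.v *)
From mathcomp Require Import all_boot.

Set Implicit Arguments.
Unset Strict Implicit.
Unset Printing Implicit Defensive.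

Record sgraph := SGraph {
  vertex :> finType;
  adj : rel vertex;
  adj_sym : symmetric adj;
  adj_irrefl : irreflexive adj
}.

Definition graph_iso (G H : sgraph) : Prop :=
  exists2 f : G -> H, bijective f & forall x y : G, adj (f x) (f y) = adj x y.

Definition degree (G : sgraph) (x : G) : nat := #|[set y | adj x y]|.

(* Every degree is below #|G|, so the default value of the iterated minimum
   only matters for the graph with no vertex. *)
Definition min_degree (G : sgraph) : nat :=
  \big[minn/#|G|]_(x : G) degree x.

Definition edges (G : sgraph) : {set {set G}} :=
  [set [set p.1; p.2] | p : G * G & adj p.1 p.2].

Definition matching (G : sgraph) (M : {set {set G}}) : bool :=
  (M \subset edges G) && trivIset M.

Section DeleteEdges.
Variables (G : sgraph) (M : {set {set G}}).

Definition del_adj : rel G := [rel x y | adj x y && ([set x; y] \notin M)].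

Lemma del_adj_sym : symmetric del_adj.
Proof. by move=> x y; rewrite /del_adj /= adj_sym setUC. Qed.

Lemma del_adj_irrefl : irreflexive del_adj.
Proof. by move=> x; rewrite /del_adj /= adj_irrefl. Qed.

Definition del_edges : sgraph := SGraph del_adj_sym del_adj_irrefl.

End DeleteEdges.

(* Connectedness of the subgraph of G induced on A. *)
Definition connected_in (G : sgraph) (A : {set G}) : bool :=
  [forall x in A, forall y in A,
     connect [rel u v | [&& u \in A, v \in A & adj u v]] x y].

Definition k_connected (k : nat) (G : sgraph) : bool :=
  (k < #|G|) && [forall S : {set G}, (#|S| < k) ==> connected_in (~: S)].

Definition k_removable (k : nat) (G : sgraph) (M : {set {set G}}) : bool :=
  matching M && k_connected k (del_edges M).

Section CompleteGraph.
Variable n : nat.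

Definition complete_adj : rel 'I_n := [rel i j | i != j].

Lemma complete_adj_sym : symmetric complete_adj.
Proof. by move=> i j; rewrite /complete_adj /= eq_sym. Qed.

Lemma complete_adj_irrefl : irreflexive complete_adj.
Proof. by move=> i; rewrite /complete_adj /= eqxx. Qed.

Definition complete_graph : sgraph :=
  SGraph complete_adj_sym complete_adj_irrefl.

End CompleteGraph.

Section CycleGraph.
Variable n : nat.

(* The conjunct i != j only matters for n = 1. *)
Definition cycle_adj : rel 'I_n :=
  [rel i j | (i != j) && ((j == ordS i) || (i == ordS j))].

Lemma cycle_adj_sym : symmetric cycle_adj.
Proof. by move=> i j; rewrite /cycle_adj /= eq_sym orbC. Qed.

Lemma cycle_adj_irrefl : irreflexive cycle_adj.
Proof. by move=> i; rewrite /cycle_adj /= eqxx. Qed.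

Definition cycle_graph : sgraph := SGraph cycle_adj_sym cycle_adj_irrefl.

End CycleGraph.

Definition is_cycle (G : sgraph) : Prop :=
  exists2 n : nat, 3 <= n & graph_iso G (cycle_graph n).

(* Main.v *)
Require Import Defs.
From mathcomp Require Import all_boot zify.

Set Implicit Arguments.
Unset Strict Implicit.
Unset Printing Implicit Defensive.

(** Let M be a removable matching with |M| < m, put H = G - M and let U be the set
of vertices not covered by M.  If M cannot be enlarged, every edge of G[U] is
critical in H, and all vertices of U have degree > k in H, so by Mader's theorem
G[U] is a forest.  A vertex of U of degree at most 1 in this forest is adjacent to
all covered vertices but at most one.  For two such vertices u and v and an edge
xy of M, one replaces xy by ux and vy.  This works as soon as M - xy + ux and
M - xy + vy are both removable; if M - xy + ux is not, the corresponding
separation contains, on the side of x, two other leaves of the forest for which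
the exchange does work.  The only case in which no edge xy of M can be used is
|M| = k = 1, where a count of degrees in the forest shows that G is a
cycle. *)

(** * Critical edges and Mader's theorem *)

Section CriticalEdges.
Variables (T : finType) (k : nat) (r : rel T).
Hypotheses (r_sym : symmetric r) (r_irr : irreflexive r).
Implicit Types (A B W : {set T}) (x y z : T).

(** The cut condition of [k]-connectedness, phrased by the two separated sides instead of by paths,
    for an arbitrary relation [r]. *)
Definition separation_bound : Prop :=
  forall A B x y, x \in A -> y \in B -> [disjoint A & B] ->
    {in A & B, forall a b, ~~ r a b} -> k <= #|~: (A :|: B)|.

(** A witness that deleting [xy] creates a separator of fewer than [k] vertices. That [xy] is an
    edge at all is not recorded, since it follows from [separation_bound]. *)
Definition critical_sep x y A B : Prop :=
  [/\ x \in A, y \in B, [disjoint A & B],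
      {in A & B, forall a b, r a b -> a = x /\ b = y}
    & #|~: (A :|: B)| < k].

Lemma critical_sepC x y A B : critical_sep x y A B -> critical_sep y x B A.
Proof.
case=> xA yB dAB AB S; split=> //; first by rewrite disjoint_sym.
  by move=> a b aB bA; rewrite r_sym => /(AB b a bA aB)[-> ->].
by rewrite setUC.
Qed.

Lemma disjointF A B : [disjoint A & B] -> forall x, (x \in A) && (x \in B) = false.
Proof. by move/setDidPl=> <- x; rewrite inE; case: (x \in B); rewrite ?andbF. Qed.

Lemma card_setU1_le x A : #|x |: A| <= #|A|.+1.
Proof. by rewrite cardsU1; case: (x \notin A). Qed.

(** Submodularity of separators for opposite corners: each vertex is counted on the left at most as
    often as on the right. *)
Lemma card_corners A B A' B' : [disjoint A & B] -> [disjoint A' & B'] ->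
  #|~: (A :&: A' :|: (B :|: B'))| + #|~: (A :|: A' :|: (B :&: B'))|
    <= #|~: (A :|: B)| + #|~: (A' :|: B')|.
Proof.
move=> /disjointF dAB /disjointF dAB'.
rewrite -cardsUI -[leqRHS]cardsUI leq_add // subset_leq_card //; apply/subsetP=> v;
  move: (dAB v) (dAB' v); rewrite !inE;
  by case: (v \in A); case: (v \in B); case: (v \in A'); case: (v \in B').
Qed.



(* The edge xy cannot cross (A', B') since xz is the only edge that does, so
   nothing leaves B :&: B'; a common vertex would make its small boundary a cut. *)
Lemma critical_corner x y z A B A' B' :
    separation_bound -> k < #|[set v | r x v]| -> y != z ->
    critical_sep x y A B -> critical_sep x z A' B' ->
  k <= #|~: (A :&: A' :|: (B :|: B'))|.+1 /\ [disjoint B & B'].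
Proof.
move=> sepb degx yz [xA yB dAB AB S] [xA' zB' dAB' AB' S'].
set S1 := ~: (A :&: A' :|: (B :|: B')).
have dABF := disjointF dAB; have dABF' := disjointF dAB'.
have xB : x \notin B by move: (dABF x); rewrite xA /= => ->.
have xB' : x \notin B' by move: (dABF' x); rewrite xA' /= => ->.
have le_k_S1 : k <= #|S1|.+1.
  (* If the corner is just [x], the more than [k] neighbours of [x] lie in [S1], [y] and [z];
     otherwise [S1] together with [x] separates the rest of the corner from [B :|: B']. *)
  have [AA'x|[a]] := set_0Vmem ((A :&: A') :\ x).
    have sub : [set v | r x v] \subset y |: (z |: S1).
      apply/subsetP=> v; rewrite !inE => rxv.
      have [/(AB _ _ xA)/(_ rxv)[_ ->]|vB] := boolP (v \in B); first by rewrite eqxx.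
      have [/(AB' _ _ xA')/(_ rxv)[_ ->]|vB'] := boolP (v \in B').
        by rewrite eqxx /= orbT.
      have/setP/(_ v) := AA'x; rewrite !inE.
      have [vx|_] := eqVneq v x; last by move=> /= ->; rewrite !orbT.
      by rewrite vx r_irr in rxv.
    rewrite -ltnS (leq_trans degx) // (leq_trans (subset_leq_card sub)) //.
    by rewrite (leq_trans (card_setU1_le _ _)) // ltnS card_setU1_le.
  rewrite !inE => /and3P[ax aA aA'].
  have dis : [disjoint A :&: A' :\ x & B :|: B'].
    rewrite -setI_eq0; apply/eqP/setP=> v; move: (dABF v) (dABF' v); rewrite !inE.
    by case: (v \in A); case: (v \in B); case: (v \in A'); case: (v \in B');
       rewrite /= ?andbF.
  have := sepb (A :&: A' :\ x) (B :|: B') a y; rewrite !inE ax aA aA' yB.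
  move=> /(_ isT isT dis) h.
  apply: (leq_trans (h _)) => [v w|].
    rewrite !inE => /and3P[vx vA vA'] /orP[wB|wB']; apply: contraNN vx.
      by move=> /(AB _ _ vA wB)[-> _].
    by move=> /(AB' _ _ vA' wB')[-> _].
  have sub : ~: (A :&: A' :\ x :|: (B :|: B')) \subset x |: S1.
    by apply/subsetP=> v; rewrite !inE; case: (v == x).
  exact: leq_trans (subset_leq_card sub) (card_setU1_le _ _).
split=> //; apply/pred0Pn=> -[b /andP[/= bB bB']].
have := card_corners dAB dAB'; rewrite -/S1.
have dis : [disjoint B :&: B' & A :|: A'].
  rewrite -setI_eq0; apply/eqP/setP=> v; move: (dABF v) (dABF' v); rewrite !inE.
  by case: (v \in A); case: (v \in B); case: (v \in A'); case: (v \in B').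
have yB' : y \notin B'.
  apply/negP=> yB'; suff rxy : r x y.
    by have [_ yz'] := AB' x y xA' yB' rxy; rewrite yz' eqxx in yz.
  (* Without the edge [xy] nothing would cross [(A, B)], and its separator would be too small. *)
  apply/negPn/negP=> nrxy.
  have := sepb A B x y xA yB dAB; rewrite leqNgt S => /(_ _)/notF; apply.
  move=> v w vA wB; apply: contraNN nrxy => rvw.
  by have [<- <-] := AB v w vA wB rvw.
have zB : z \notin B.
  apply/negP=> zB; suff rxz : r x z.
    by have [_ yz'] := AB x z xA zB rxz; rewrite yz' eqxx in yz.
  apply/negPn/negP=> nrxz.
  have := sepb A' B' x z xA' zB' dAB'; rewrite leqNgt S' => /(_ _)/notF; apply.
  move=> v w vA wB; apply: contraNN nrxz => rvw.
  by have [<- <-] := AB' v w vA wB rvw.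
have := sepb (B :&: B') (A :|: A') b x; rewrite !inE bB bB' xA => /(_ isT isT dis).
rewrite [B :&: B' :|: _]setUC => h.
suff /h : {in B :&: B' & A :|: A', forall a b : T, ~~ r a b}.
  by move: S S' le_k_S1; clear; lia.
move=> v w; rewrite !inE r_sym => /andP[vB vB'] /orP[wA|wA']; apply/negP.
  by move=> /(AB _ _ wA vB)[_ vy]; rewrite vy (negPf yB') in vB'.
by move=> /(AB' _ _ wA' vB')[_ vz]; rewrite vz (negPf zB) in vB.
Qed.

(* Mader's theorem on cycles of critical edges.  Take a critical edge xy inside W
   and a side A of one of its separations with #|A| minimal, and a second critical
   edge xz with far side B'.  Disjointness of B and B' then makes the corner
   separator smaller than S by at least #|A :&: A'| + #|B'| - #|A| > 0. *)
Lemma critical_acyclic W :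
    separation_bound -> W != set0 -> {in W, forall x, k < #|[set v | r x v]|} ->
    {in W &, forall x y, r x y -> exists A B, critical_sep x y A B} ->
  exists2 x, x \in W & #|[set y in W | r x y]| <= 1.
Proof.
move=> sepb /set0Pn[w wW] degW crit.
have [/exists_inP//|/exists_inPn deg2] := boolP [exists x in W, #|[set y in W | r x y]| <= 1].
suff noA n A B x y : #|A| = n -> x \in W -> y \in W -> r x y -> ~ critical_sep x y A B.
  have /card_gt1P[y [z [+ _ _]]] : 1 < #|[set y in W | r w y]| by rewrite ltnNge deg2.
  rewrite inE => /andP[yW rwy]; have [A [B AB]] := crit w y wW yW rwy.
  by case: (noA _ A B w y erefl).
elim/ltn_ind: n A B x y => n IHn A B x y An xW yW rxy AB.
have /card_gt1P[y1 [y2 []]] : 1 < #|[set y in W | r x y]| by rewrite ltnNge deg2.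
rewrite !inE => /andP[y1W rxy1] /andP[y2W rxy2] y12.
have [z [zW rxz yz]] : exists z, [/\ z \in W, r x z & y != z].
  have [yy1|] := eqVneq y y1; last by exists y1.
  by exists y2; split=> //; rewrite yy1.
have [A' [B' AB']] := crit x z xW zW rxz.
have [le_k dBB'] := critical_corner sepb (degW x xW) yz AB AB'.
(* [B'] is itself a side for the critical edge [zx], so it cannot be smaller than the minimal
   [A]. *)
have leAB' : #|A| <= #|B'|.
  rewrite An leqNgt; apply/negP=> ltB'n.
  by apply: (IHn _ ltB'n B' A' z x) => //; [rewrite r_sym|apply: critical_sepC].
case: AB AB' => [xA yB dAB _ S] [xA' zB' dAB' _ S'].
have AA' : 0 < #|A :&: A'| by apply/card_gt0P; exists x; rewrite inE xA.
have dis : [disjoint A :&: A' & B :|: B'].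
  rewrite -setI_eq0; apply/eqP/setP=> v; move: (disjointF dAB v) (disjointF dAB' v).
  rewrite !inE.
  by case: (v \in A); case: (v \in B); case: (v \in A'); case: (v \in B').
move: dis dBB' dAB; rewrite -!setI_eq0 => /eqP dis /eqP dBB' /eqP dAB.
have := cardsC (A :&: A' :|: (B :|: B')); have := cardsC (A :|: B).
rewrite !cardsU dis dBB' dAB cards0.
by move: S S' le_k AA' leAB'; clear; lia.
Qed.

End CriticalEdges.

(** * Separations and [k]-connectedness *)

(** A path that starts in [A] and avoids the separator can never leave [A]. *)
Lemma k_connected_bound k (G : sgraph) :
  k_connected k G -> separation_bound k (@adj G).
Proof.
move=> /andP[_ /forallP conn] A B x y xA yB dAB nAB.
rewrite leqNgt; apply/negP=> ltk.
have /implyP/(_ ltk) := conn (~: (A :|: B)); rewrite setCK.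
move=> /forall_inP/(_ x); rewrite !inE xA => /(_ isT)/forall_inP/(_ y).
rewrite inE yB orbT => /(_ isT) /connectP[p].
elim: p x xA => [|z p IHp] x xA /=.
  by move=> _ yx; have := disjointF dAB x; rewrite xA -yx yB.
move=> /andP[/and3P[_ zAB xz]]; apply: IHp.
by move: zAB; rewrite inE => /orP[//|/(nAB _ _ xA)]; rewrite xz.
Qed.

(** [A] is the component of [x] after deletion of a small set [S], and [B] is everything else
    outside [S]. *)
Lemma not_k_connectedP k (G : sgraph) : k < #|G| -> ~~ k_connected k G ->
  exists (A B : {set G}) x y, [/\ x \in A, y \in B, [disjoint A & B],
    {in A & B, forall a b : G, ~~ adj a b} & #|~: (A :|: B)| < k].
Proof.
rewrite /k_connected => -> /= /forallPn[S]; rewrite negb_imply => /andP[ltS].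
move=> /forall_inPn[x xS] /forall_inPn[y yS] nxy.
pose e := [rel u v : G | [&& u \in ~: S, v \in ~: S & adj u v]].
pose A := [set v in ~: S | connect e x v].
exists A, (~: S :\: A), x, y; split.
- by rewrite inE xS connect0.
- by rewrite 2!inE yS (negPf nxy).
- by rewrite -setI_eq0; apply/eqP/setP=> v; rewrite !inE; case: (v \in S) (connect _ _ _) => [] [].
- move=> a b; rewrite inE => /andP[aS xa]; rewrite !inE => /andP[nb bS].
  apply: contraNN nb => ab; rewrite bS /=; apply: connect_trans xa (connect1 _).
  by rewrite /= aS ab inE bS.
- apply: leq_ltn_trans ltS; apply/subset_leq_card/subsetP=> v; rewrite !inE.
  by case: (v \in S) (connect _ _ _) => [] [].
Qed.


Lemma not_k_connected_del k (G : sgraph) (D : {set {set G}}) :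
    k < #|G| -> ~~ k_connected k (del_edges D) ->
  exists (A B : {set G}) x y, [/\ x \in A, y \in B, [disjoint A & B],
    {in A & B, forall a b : G, adj a b -> [set a; b] \in D} & #|~: (A :|: B)| < k].
Proof.
move=> ltk /(not_k_connectedP (G := del_edges D) ltk)[A [B [x [y [xA yB dAB nAB S]]]]].
exists A, B, x, y; split=> // a b aA bB ab; apply/negPn/negP=> nab.
have : ~~ del_adj D a b := nAB a b aA bB.
by rewrite /del_adj /= ab nab.
Qed.

Lemma set2_inj (T : finType) (a b x y : T) :
  [set a; b] = [set x; y] -> (a = x /\ b = y) \/ (a = y /\ b = x).
Proof.
move=> E; have /set2P : a \in [set x; y] by rewrite -E set21.
have /set2P : b \in [set x; y] by rewrite -E set22.
have /set2P : x \in [set a; b] by rewrite E set21.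
have /set2P : y \in [set a; b] by rewrite E set22.
by case=> ? [] ? [] ? [] ?; subst; auto.
Qed.

(** * Leaves and degree sums in forests *)

Section Forest.
Variables (T : finType) (e : rel T).
Hypotheses (e_sym : symmetric e) (e_irr : irreflexive e).
Implicit Types (W Q : {set T}).

Definition degree_in W w := #|[set v in W | e w v]|.

Variable U : {set T}.
(** A forest is encoded by a vertex of degree at most 1 in every nonempty subset, which is exactly
    what Mader's theorem provides. *)
Hypothesis forestU : forall W, W \subset U -> W != set0 ->
  exists2 w, w \in W & degree_in W w <= 1.

Lemma degree_inD1 W w v : w \in W ->
  degree_in W v = e v w + degree_in (W :\ w) v.
Proof.
move=> wW; rewrite /degree_in (cardsD1 w) inE wW /=; congr (_ + #|pred_of_set _|).
by apply/setP=> x; rewrite !inE andbA.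
Qed.

Lemma degree_in_gt0 W w : reflect (exists2 v, v \in W & e w v) (0 < degree_in W w).
Proof.
apply: (iffP card_gt0P) => -[v]; first by rewrite inE => /andP[]; exists v.
by move=> vW wv; exists v; rewrite inE vW.
Qed.

Lemma card_gt1_of_degree_in W w : 0 < degree_in W w -> w \in W -> 1 < #|W|.
Proof.
move=> /degree_in_gt0[v vW wv] wW; apply/card_gt1P; exists v, w; split=> //.
by apply: contraTneq wv => ->; rewrite e_irr.
Qed.

(** Induction by removing a leaf [w]: if both leaves of the rest were adjacent to [w], then [w]
    would have degree 2. Isolated vertices count as leaves. *)
Lemma forest_two_leaves W : W \subset U -> 1 < #|W| ->
  exists w1 w2, [/\ w1 \in W, w2 \in W, w1 != w2, degree_in W w1 <= 1
    & degree_in W w2 <= 1].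
Proof.
have [n] := ubnP #|W|; elim: n W => // n IHn W ltWn WU W1.
have [|w wW lew] := forestU WU; first by rewrite -card_gt0 ltnW.
have W'U : W :\ w \subset U by apply: subset_trans WU; apply: subsetDl.
have cW := cardsD1 w W; rewrite wW in cW.
have W'0 : W :\ w != set0 by rewrite -card_gt0; lia.
suff [v [vW' levW nwv]] : exists v, [/\ v \in W :\ w, degree_in (W :\ w) v <= 1
    & e v w -> degree_in (W :\ w) v = 0].
  move: vW'; rewrite !inE => /andP[vw vW]; exists w, v; split=> //; first by rewrite eq_sym.
  by rewrite (degree_inD1 v wW); case: (e v w) nwv => [-> //|_].
have [lt1|le1] := ltnP 1 #|W :\ w|; last first.
  have [v vW' _] := forestU W'U W'0; exists v.
  have deg0 : degree_in (W :\ w) v = 0.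
    apply/eqP; rewrite -leqn0 leqNgt; apply/negP=> /card_gt1_of_degree_in/(_ vW').
    by rewrite ltnNge le1.
  by rewrite deg0; split.
have [|w1 [w2 [w1W w2W w12 le_w1 le_w2]]] := IHn _ _ W'U lt1; first by lia.
have [ew1|] := boolP (e w1 w); last by move=> /negPf ne; exists w1; split; rewrite ?ne.
have [ew2|] := boolP (e w2 w); last by move=> /negPf ne; exists w2; split; rewrite ?ne.
have : 1 < degree_in W w; last by rewrite ltnNge lew.
apply/card_gt1P; exists w1, w2; split=> //; rewrite inE e_sym ?ew1 ?ew2 andbT.
  by move: w1W; rewrite inE => /andP[].
by move: w2W; rewrite inE => /andP[].
Qed.

(** A forest has fewer edges than vertices, here in doubled form: removing a vertex of degree at
    most 1 lowers the degree sum by at most 2. *)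
Lemma forest_degree_sum W : W \subset U -> W != set0 ->
  (\sum_(w in W) degree_in W w).+2 <= 2 * #|W|.
Proof.
have [n] := ubnP #|W|; elim: n W => // n IHn W ltWn WU W0.
have [w wW lew] := forestU WU W0.
have W'U : W :\ w \subset U by apply: subset_trans WU; apply: subsetDl.
have cW := cardsD1 w W; rewrite wW in cW.
rewrite (big_setD1 w) //=; under eq_bigr => v _ do rewrite (degree_inD1 v wW).
rewrite big_split /=.
have -> : \sum_(v in W :\ w) e v w = degree_in W w.
  rewrite (degree_inD1 w wW) e_irr add0n /degree_in -sum1_card big_mkcond /=.
  rewrite [RHS]big_mkcond; apply: eq_bigr => v _.
  by rewrite [in RHS]inE e_sym; case: (v \in _) (e w v) => [] [].
have [W'0|W'0] := eqVneq (W :\ w) set0.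
  have deg0 : degree_in W w = 0.
    rewrite (degree_inD1 w wW) e_irr add0n W'0; apply/eqP; rewrite cards_eq0.
    by apply/eqP/setP=> v; rewrite !inE.
  by rewrite deg0 W'0 big_set0 cW W'0 cards0.
have := IHn _ _ W'U W'0; rewrite cW; move: ltWn lew; rewrite cW; clear; lia.
Qed.

End Forest.

(** * Matchings and their covered vertices *)

Section Matching.
Variable G : sgraph.
Implicit Types (M : {set {set G}}) (x y : G).

Lemma edges_adj x y : ([set x; y] \in edges G) = adj x y.
Proof.
apply/imsetP/idP=> [[[a b]]|xy]; last by exists (x, y); rewrite ?inE.
rewrite inE /= => ab /set2_inj[[-> ->]|[-> ->]]; first exact: ab.
by rewrite adj_sym.
Qed.

Lemma matching_adj M x y : matching M -> [set x; y] \in M -> adj x y.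
Proof. by move=> /andP[/subsetP sub _] /sub; rewrite edges_adj. Qed.

Lemma coverP M x : matching M ->
  reflect (exists y, [set x; y] \in M) (x \in cover M).
Proof.
move=> /andP[/subsetP sub _]; apply: (iffP bigcupP) => [[A AM xA]|[y xyM]].
  have /imsetP[[a b] _ Aab] := sub A AM; rewrite Aab /= in AM xA.
  case/set2P: xA AM => -> AM; first by exists b.
  by exists a; rewrite setUC.
by exists [set x; y] => //; rewrite set21.
Qed.

Lemma matching_unique M x y z : matching M ->
  [set x; y] \in M -> [set x; z] \in M -> z = y.
Proof.
move=> mM xyM xzM; have /andP[_ /trivIsetP/(_ _ _ xyM xzM)] := mM.
have [/set2_inj[[_ ->]//|[-> ->]//]|_ /(_ isT)] := eqVneq.
by move/disjointF/(_ x); rewrite !set21.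
Qed.

Lemma card_cover M : matching M -> #|cover M| = 2 * #|M|.
Proof.
move=> mM; have /andP[/subsetP sub /eqP <-] := mM.
rewrite mulnC -sum_nat_const; apply: eq_bigr => A AM.
have /imsetP[[a b]] := sub A AM; rewrite inE /= => ab ->.
rewrite cards2; suff -> : a != b by [].
by apply: contraTneq ab => ->; rewrite adj_irrefl.
Qed.

Lemma matchingU1 M x y : matching M -> adj x y ->
    x \notin cover M -> y \notin cover M ->
  matching ([set x; y] |: M) /\ #|[set x; y] |: M| = #|M|.+1.
Proof.
move=> mM xy xM yM; have /andP[sub tM] := mM.
have xyM : [set x; y] \notin M.
  by apply: contraNN xM => xyM; apply/coverP => //; exists y.
have dis A : A \in M -> [disjoint [set x; y] & A].
  move=> AM; rewrite -setI_eq0; apply/eqP/setP=> z; rewrite !inE.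
  apply/negbTE/negP=> /andP[/orP[]/eqP -> zA].
    by case/negP: xM; apply/bigcupP; exists A.
  by case/negP: yM; apply/bigcupP; exists A.
split; last by rewrite cardsU1 xyM.
apply/andP; split; first by rewrite subUset sub1set edges_adj xy.
apply/trivIsetP=> A B; rewrite !inE.
case/orP=> [/eqP->|AM] /orP[/eqP->|BM]; rewrite ?eqxx // => AB.
- exact: dis.
- by rewrite disjoint_sym dis.
- exact: (trivIsetP tM).
Qed.

Lemma matchingD1 M x y : matching M -> [set x; y] \in M ->
  [/\ matching (M :\ [set x; y]), #|M :\ [set x; y]|.+1 = #|M|
    & forall z, (z \in cover (M :\ [set x; y])) = (z \in cover M) && (z \notin [set x; y])].
Proof.
move=> mM xyM; have /andP[sub tM] := mM.
have mM' : matching (M :\ [set x; y]).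
  rewrite /matching (subset_trans (subsetDl _ _) sub) /=.
  by apply: trivIsetS tM; apply: subsetDl.
split=> //; first by rewrite [RHS](cardsD1 [set x; y]) xyM.
by move=> z; rewrite coverD1 // in_setD andbC.
Qed.

End Matching.

(** * Enlarging a removable matching *)

Section Exchange.
Variables (k : nat) (G : sgraph) (M : {set {set G}}).
Hypotheses (k_gt0 : 0 < k) (mM : matching M).
Hypothesis connM : k_connected k (del_edges M).
(** The two halves of the minimum degree condition for |M| < m. Since [M] covers 2|M| vertices, the
    second makes every degree at least the number of covered vertices. *)
Hypotheses (deg_k : forall x : G, k < degree x)
           (deg_M : forall x : G, 2 * #|M| <= degree x).
Hypothesis maxM : forall M' : {set {set G}}, k_removable k M' -> #|M'| != #|M|.+1.
Implicit Types (x y u v w : G) (A B W : {set G}).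

Let r : rel G := del_adj M.
Let C := cover M.
Let U := ~: C.
Let leafy u := degree_in (@adj G) U u <= 1.

Let r_sym : symmetric r. Proof. exact: del_adj_sym. Qed.
Let r_irr : irreflexive r. Proof. exact: del_adj_irrefl. Qed.

Let bound_r : separation_bound k r.
Proof. exact: (k_connected_bound connM). Qed.

Let card_k : k < #|G|. Proof. by case/andP: connM. Qed.

Let rU u v : u \in U -> r u v = adj u v.
Proof.
rewrite inE => uC; rewrite /r /del_adj /=; case: adj => //=.
by apply: contraNN uC => uvM; apply/coverP => //; exists v.
Qed.

Let r_matched x y v : [set x; y] \in M -> adj x v -> v != y -> r x v.
Proof.
move=> xyM xv vy; rewrite /r /del_adj /= xv /=.
by apply: contraNN vy => /(matching_unique mM xyM) ->.
Qed.

(** An edge of G - M across a separation of G - D lies in [D] but not in [M], so it is [xy]; one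
    exists because G - M is [k]-connected. [D] may omit edges of [M], and the last clause then keeps
    these from crossing. *)
Let critical_edge D x y : ~~ k_connected k (del_edges D) ->
    D \subset [set x; y] |: M ->
  exists A B, critical_sep k r x y A B /\
    {in A & B, forall a b, adj a b -> [set a; b] \in D}.
Proof.
move=> nconn subD.
have [A [B [a [b [aA bB dAB inD ltk]]]]] := not_k_connected_del card_k nconn.
have xyE : {in A & B, forall v w : G, r v w -> [set v; w] = [set x; y]}.
  move=> v w vA wB /andP[/(inD v w vA wB)/(subsetP subD) + nM].
  by rewrite in_setU1 (negPf nM) orbF => /eqP.
have [v [w [vA wB rvw]]] : exists v w, [/\ v \in A, w \in B & r v w].
  have [/exists_inP[v vA /exists_inP[w wB vw]]|nex] :=
    boolP [exists v in A, exists w in B, r v w]; first by exists v, w.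
  exfalso; have := bound_r aA bB dAB; rewrite leqNgt ltk => /(_ _)/notF; apply=> v w vA wB.
  by apply: contraNN nex => vw; apply/exists_inP; exists v => //; apply/exists_inP; exists w.
have ABF := disjointF dAB.
case: (set2_inj (xyE v w vA wB rvw)) => -[? ?]; subst v w.
  exists A, B; split=> //; split=> // v w vA' wB' /(xyE v w vA' wB')/set2_inj[//|[? ?]].
  by subst v w; have := ABF y; rewrite vA' wB.
exists B, A; split.
  split=> //; first by rewrite disjoint_sym.
    move=> v w vA' wB'; rewrite r_sym => /(xyE w v wB' vA')/set2_inj[|] [? ?]; subst v w => //.
    by have := ABF x; rewrite wB' wB.
  by rewrite setUC.
by move=> v w vB wA; rewrite adj_sym setUC; apply: inD.
Qed.

Let critical_U u v : u \in U -> v \in U -> adj u v ->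
  exists A B, critical_sep k r u v A B.
Proof.
rewrite !inE => uC vC uv; have [mM' cM'] := matchingU1 mM uv uC vC.
have nconn : ~~ k_connected k (del_edges ([set u; v] |: M)).
  apply/negP=> conn; have := @maxM ([set u; v] |: M).
  by rewrite /k_removable mM' conn cM' eqxx => /(_ isT).
by have [A [B [AB _]]] := critical_edge nconn (subxx _); exists A, B.
Qed.

Let degree_r u : u \in U -> #|[set v | r u v]| = degree u.
Proof. by move=> uU; apply: eq_card => v; rewrite !inE rU. Qed.

(** Mader's theorem applies because vertices of [U] lose no edge in G - M and keep degree above
    [k]. *)
Let forestU W : W \subset U -> W != set0 ->
  exists2 w, w \in W & degree_in (@adj G) W w <= 1.
Proof.
move=> /subsetP WU W0.
have [||w wW le1] := critical_acyclic r_sym r_irr bound_r W0.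
- by move=> w /WU wU; rewrite degree_r.
- by move=> v w /WU vU /WU wU; rewrite rU //; apply: critical_U.
exists w => //; apply: leq_trans le1; apply/eq_leq/eq_card => v.
by rewrite !inE rU // WU.
Qed.

Let two_leaves := forest_two_leaves (@adj_sym G) (@adj_irrefl G) forestU.

Let degree_split u : degree u = degree_in (@adj G) U u + #|[set v in C | adj u v]|.
Proof.
rewrite /degree /degree_in -(cardsID U) addnC [RHS]addnC.
by congr (_ + _); apply: eq_card => v; rewrite !inE ?negbK andbC.
Qed.

(** The degree of [u] is at least the size of [C], so each covered nonneighbour is made up for by a
    neighbour in [U]. *)
Let nonneighbours u : #|[set v in C | ~~ adj u v]| <= degree_in (@adj G) U u.
Proof.
have : #|[set v in C | adj u v]| + #|[set v in C | ~~ adj u v]| = #|C|.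
  rewrite -[RHS](cardsID [set v | adj u v]).
  by congr (_ + _); apply: eq_card => v; rewrite !inE // andbC.
have := deg_M u; rewrite degree_split card_cover //.
by clear; lia.
Qed.

Let nonneighbour_unique u p q : leafy u -> p \in C -> q \in C ->
  ~~ adj u p -> ~~ adj u q -> p = q.
Proof.
move=> lu pC qC np nq; apply: contraTeq lu => pq; rewrite -ltnNge.
apply: leq_trans (nonneighbours u); apply/card_gt1P; exists p, q.
by split; rewrite // inE ?pC ?qC.
Qed.

(** Outside [B], the vertex [b] sees only the fewer than [k] separator vertices, and [x] if [b] is
    [y]. *)
Let side_degree x y A B b : critical_sep k r x y A B -> b \in B ->
  #|[set v | r b v]| < degree_in r B b + k + (b == y).
Proof.
move=> [xA yB dAB AB S] bB.
pose X := if b == y then [set x] else set0.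
have sub : [set v | r b v] \subset [set v in B | r b v] :|: ~: (A :|: B) :|: X.
  apply/subsetP=> v; rewrite !inE => bv; rewrite bv andbT.
  have [//|vB] := boolP (v \in B); rewrite orbF.
  have [vA /=|//] := boolP (v \in A).
  have [-> by_] := AB v b vA bB (etrans (r_sym _ _) bv).
  by rewrite /X by_ eqxx set11.
apply: leq_ltn_trans (subset_leq_card sub) _.
have := leq_of_leqif (leq_card_setU ([set v in B | r b v] :|: ~: (A :|: B)) X).
have := leq_of_leqif (leq_card_setU [set v in B | r b v] (~: (A :|: B))).
have -> : #|X| = (b == y) by rewrite /X; case: ifP; rewrite ?cards1 ?cards0.
by move: S; rewrite /degree_in; clear; lia.
Qed.

(* Otherwise the far side of a separation of uv lies in U, where all its vertices
   but v have two neighbours in that side, contradicting acyclicity. *)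
Let leaf_misses u v : u \in U -> v \in U -> adj u v -> leafy u ->
  exists A B, critical_sep k r u v A B /\ exists p, [/\ p \in B, p \in C & ~~ adj u p].
Proof.
move=> uU vU uv lu; have [A [B cAB]] := critical_U uU vU uv.
exists A, B; split=> //; have [uA vB dAB AB S] := cAB.
have [BC|[p]] := set_0Vmem (B :&: C); last first.
  rewrite inE => /andP[pB pC]; exists p; split=> //; apply/negP=> up.
  have [_ pv] := AB u p uA pB (etrans (rU _ uU) up).
  by rewrite inE -pv pC in vU.
have subBU : B \subset U.
  apply/subsetP=> b bB; rewrite inE; apply/negP=> bC.
  by move/setP/(_ b): BC; rewrite in_setI bB bC inE.
have degB b : b \in B -> 1 < degree_in (@adj G) B b + (b == v).
  move=> bB; have bU := subsetP subBU b bB.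
  have := side_degree cAB bB; rewrite degree_r // => h.
  have <- : degree_in r B b = degree_in (@adj G) B b.
    by apply: eq_card => w; rewrite !inE rU.
  by have := deg_k b; move: h; clear; lia.
have := degB v vB; rewrite eqxx addn1 ltnS => /(card_gt1_of_degree_in (@adj_irrefl G))/(_ vB).
move=> /(two_leaves subBU)[w1 [w2 [w1B w2B w12 l1 l2]]].
have [w1v|w1v] := eqVneq w1 v.
  by have := degB w2 w2B; rewrite -w1v eq_sym (negPf w12) addn0 ltnNge l2.
by have := degB w1 w1B; rewrite (negPf w1v) addn0 ltnNge l1.
Qed.

Let degree_U_gt0 u : degree_in (@adj G) U u != 0 -> exists2 v, v \in U & adj u v.
Proof. by rewrite -lt0n => /degree_in_gt0. Qed.

(** A leaf with a neighbour in [U] misses a covered vertex, so in every case its degree, which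
    exceeds [k], is at most the size of [C]. *)
Let leafy_bound u : u \in U -> leafy u -> k < 2 * #|M|.
Proof.
move=> uU lu; apply: leq_trans (deg_k u) _; rewrite degree_split -card_cover //.
have cC : #|[set v in C | adj u v]| + #|[set v in C | ~~ adj u v]| = #|C|.
  rewrite -[RHS](cardsID [set v | adj u v]).
  by congr (_ + _); apply: eq_card => v; rewrite !inE // andbC.
rewrite -/C -cC addnC leq_add2l.
have [->//|/degree_U_gt0[v vU uv]] := eqVneq (degree_in (@adj G) U u) 0.
have [A [B [_ [p [_ pC np]]]]] := leaf_misses uU vU uv lu.
by apply: leq_trans lu _; apply/card_gt0P; exists p; rewrite inE pC.
Qed.

(** * Exchanging an edge of the matching for two new ones *)

(** [xy] cannot be replaced by [ux]; of the two ends, [x] is the one that stays covered. *)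
Let blocked u x y := ~~ k_connected k (del_edges ([set u; x] |: (M :\ [set x; y]))).

(* A matched vertex q != x in B would be the nonneighbour of u, which also lies
   on the far side of a separation of the edge of U at u; these two far sides are
   disjoint.  So B is x together with vertices of U. *)
Let blocked_sep u x y : [set x; y] \in M -> adj u x -> u \in U -> leafy u -> blocked u x y ->
  exists A B, [/\ critical_sep k r u x A B, U \subset A :|: B, 1 < #|B :&: U|,
    {in B :&: U, forall w, 0 < degree_in (@adj G) (B :&: U) w}
    & {in B :&: U, forall w, degree_in (@adj G) (B :&: U) w <= 1 ->
        adj w x /\ adj w y}].
Proof.
move=> xyM ux uU lu blocked_u.
have [|A [B [cAB ABD]]] := critical_edge (x := u) (y := x) blocked_u.
  by apply: setUS; apply: subsetDl.
have [uA xB dAB AB S] := cAB.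
have xC : x \in C by apply/coverP => //; exists y.
have yC : y \in C by apply/coverP => //; exists x; rewrite setUC.
(* The edge [xy] is put back, so it may not cross. *)
have yA : y \notin A.
  apply/negP=> yA; have yx : adj y x by rewrite adj_sym (matching_adj mM).
  have := ABD y x yA xB yx; rewrite !inE [[set y; x]]setUC eqxx /= orbF.
  move=> /eqP/set2_inj[[xu _]|[_ yu]]; first by rewrite inE -xu xC in uU.
  by rewrite -yu inE yC in uU.
have BC q : q \in B -> q \in C -> q = x.
  move=> qB qC; apply/eqP/negPn/negP => qx.
  have nq : ~~ adj u q.
    apply: contraNN qx => uq; apply/eqP.
    by have [] := AB u q uA qB (etrans (rU _ uU) uq).
  have /degree_U_gt0[v vU uv] : degree_in (@adj G) U u != 0.
    rewrite -lt0n; apply: leq_trans (nonneighbours u); apply/card_gt0P; exists q.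
    by rewrite inE qC.
  have [A' [B' [cAB' [p [pB' pC np]]]]] := leaf_misses uU vU uv lu.
  have xv : x != v by apply: contraTneq vU => <-; rewrite inE xC.
  have [|_ dBB'] := critical_corner r_sym r_irr bound_r _ xv cAB cAB'.
    by rewrite degree_r.
  by have := disjointF dBB' q; rewrite qB (nonneighbour_unique lu qC pC nq np) pB'.
pose Q := B :&: U.
have QU : Q \subset U by apply: subsetIr.
(* At most k - 1 of the at least k + 1 neighbours of [w] are in the separator, so two are in [B],
   and at most one of these is [x]. *)
have Q_gt0 w : w \in Q -> 0 < degree_in (@adj G) Q w.
  rewrite inE => /andP[wB wU].
  have wx : w != x by apply: contraTneq wU => ->; rewrite inE xC.
  have := side_degree cAB wB; rewrite degree_r // (negPf wx) addn0.
  have : degree_in r B w <= degree_in (@adj G) Q w + 1.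
    apply: leq_trans (_ : #|x |: [set v in Q | adj w v]| <= _); last first.
      by rewrite addn1 card_setU1_le.
    apply/subset_leq_card/subsetP=> v; rewrite !inE rU // => /andP[vB ->].
    by rewrite vB andbT /=; case: (boolP (v \in C)) => [/(BC v vB) ->|]; rewrite ?eqxx ?orbT.
  by have := deg_k w; clear; lia.
(* Otherwise all neighbours of [x] would be [u] or separator vertices ([y] is one of these), at most
   [k] in all. *)
have [q qQ] : exists q, q \in Q.
  have sub : [set v | adj x v] \subset u |: (~: (A :|: B)) :|: Q.
    apply/subsetP=> v; rewrite inE => xv.
    have [vy|vy] := eqVneq v y.
      rewrite vy in xv *; rewrite !inE (negPf yA) /=.
      have [/BC/(_ yC) yx|//] := boolP (y \in B); last by rewrite orbT.
      by rewrite yx adj_irrefl in xv.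
    have rxv := r_matched xyM xv vy.
    rewrite !inE; have [vA|vA] /= := boolP (v \in A).
      by have [-> _] := AB v x vA xB (etrans (r_sym _ _) rxv); rewrite eqxx.
    have [vB|vB] /= := boolP (v \in B); last by rewrite orbT.
    apply/orP; right; apply/negP=> /(BC v vB) vx.
    by rewrite vx adj_irrefl in xv.
  have := subset_leq_card sub; have := deg_k x; rewrite /degree.
  have := leq_of_leqif (leq_card_setU (u |: ~: (A :|: B)) Q).
  have := card_setU1_le u (~: (A :|: B)).
  move: S => S h1 h2 h3 h4; apply/card_gt0P.
  by move: S h1 h2 h3 h4; clear; lia.
have Q_gt1 := card_gt1_of_degree_in (@adj_irrefl G) (Q_gt0 q qQ) qQ.
(* With only one neighbour in [Q], reaching degree k + 1 requires [x] and the whole separator. *)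
have leafQ w : w \in Q -> degree_in (@adj G) Q w <= 1 ->
    adj w x /\ ~: (A :|: B) \subset [set v | adj w v].
  move=> wQ le1; have := wQ; rewrite inE => /andP[wB wU].
  have wx : w != x by apply: contraTneq wU => ->; rewrite inE xC.
  pose N := [set v | adj w v]; pose S' := ~: (A :|: B).
  have sub : N \subset (N :&: [set x]) :|: (N :&: S') :|: [set v in Q | adj w v].
    apply/subsetP=> v; rewrite !inE => wv; rewrite wv /= andbT.
    have [vA|vA] /= := boolP (v \in A).
      have rvw : r v w by rewrite r_sym rU.
      by have [_ wx'] := AB v w vA wB rvw; rewrite wx' eqxx in wx.
    have [vB|vB] /= := boolP (v \in B); last by rewrite orbT.
    by case: (boolP (v \in C)) => [/(BC v vB) ->|]; rewrite ?eqxx ?orbT.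
  have h1 := subset_leq_card sub.
  have h2 := leq_of_leqif (leq_card_setU ((N :&: [set x]) :|: (N :&: S')) [set v in Q | adj w v]).
  have h3 := leq_of_leqif (leq_card_setU (N :&: [set x]) (N :&: S')).
  have h4 : #|N :&: [set x]| = adj w x.
    have [wx1|/negPf wx1] := boolP (adj w x).
      by rewrite (_ : _ :&: _ = [set x]) ?cards1 //; apply/setIidPr; rewrite sub1set inE.
    by apply: eq_card0 => v; rewrite !inE; case: eqP => [->|_]; rewrite ?wx1 ?andbF.
  have h5 : #|N :&: S'| <= #|S'| by apply/subset_leq_card/subsetIr.
  have h6 : k < #|N| := deg_k w.
  have [h7 h8] : adj w x /\ #|S'| <= #|N :&: S'|.
    by move: S h1 h2 h3 h4 h5 h6 le1; rewrite /degree_in -/S'; clear; case: (adj w x); lia.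
  by split=> //; apply/setIidPr/eqP; rewrite eqEcard subsetIr.
(* A vertex [s] of [U] in the separator would be adjacent to all leaves of [Q], so [s |: Q] would
   have minimum degree 2 inside the forest. *)
have UAB : U \subset A :|: B.
  apply/subsetP=> s sU; apply/negPn/negP=> sAB.
  have sQ : s \notin Q by apply: contraNN sAB; rewrite !inE => /andP[-> _]; rewrite orbT.
  have sleaf w : w \in Q -> degree_in (@adj G) Q w <= 1 -> adj w s.
    by move=> wQ le1; have [_ /subsetP/(_ s)] := leafQ w wQ le1; rewrite !inE in sAB *; apply.
  have WU : s |: Q \subset U by rewrite subUset sub1set sU.
  have [|w wW] := forestU WU; first by apply/set0Pn; exists s; rewrite !inE eqxx.
  rewrite leqNgt => /negP; apply.
  rewrite (degree_inD1 (@adj G) w (setU11 s Q)) setU1K //.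
  move: wW; rewrite in_setU1 => /orP[/eqP->|wQ].
    rewrite adj_irrefl; have [w1 [w2 [w1Q w2Q w12 l1 l2]]] := two_leaves QU Q_gt1.
    apply/card_gt1P; exists w1, w2.
    by split=> //; rewrite inE ?w1Q ?w2Q adj_sym sleaf.
  have [le1|gt1] := leqP (degree_in (@adj G) Q w) 1; last by rewrite addnC ltn_addr.
  by rewrite sleaf //= ltnS Q_gt0.
exists A, B; split=> // w wQ le1; have [wx /subsetP/(_ y)] := leafQ w wQ le1.
rewrite !inE (negPf yA) /= => h; split=> //; apply: h; apply/negP=> /BC/(_ yC) yx.
by have := matching_adj mM xyM; rewrite yx adj_irrefl.
Qed.


Let crossing D A B x y : k_connected k (del_edges D) -> x \in A -> y \in B ->
    [disjoint A & B] -> #|~: (A :|: B)| < k ->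
  exists a b, [/\ a \in A, b \in B, adj a b & [set a; b] \notin D].
Proof.
move=> /k_connected_bound bound xA yB dAB ltk.
have [/exists_inP[a aA /exists_inP[b bB /andP[]]]|nex] :=
  boolP [exists a in A, exists b in B, del_adj D a b]; first by exists a, b.
exfalso; have := bound A B x y xA yB dAB; rewrite leqNgt ltk => /(_ _)/notF; apply=> a b aA bB.
by apply: contraNN nex => ab; apply/exists_inP; exists a => //; apply/exists_inP; exists b.
Qed.

(* A small cut of the new graph separates both u from x and v from y; as xy is put
   back, u and v are on one side, and then uy or vx crosses the cut. *)
Let exchange u v x y : u \in U -> v \in U -> u != v -> [set x; y] \in M ->
  adj u x -> adj v y -> adj u y || adj v x -> ~~ blocked u x y -> ~~ blocked v y x -> False.
Proof.
move=> uU vU uv xyM ux vy uyvx.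
have yxE : [set y; x] = [set x; y] by rewrite setUC.
pose M0 := M :\ [set x; y]; rewrite /blocked yxE -/M0 => /negPn conn1 /negPn conn2.
have [mM0 cM0 coverM0] := matchingD1 mM xyM; rewrite -/M0 in mM0 cM0 coverM0.
have xC : x \in C by apply/coverP => //; exists y.
have yC : y \in C by apply/coverP => //; exists x; rewrite setUC.
have xy : adj x y := matching_adj mM xyM.
have ne : [/\ u != x, u != y, v != x, v != y & x != y].
  split; try by (apply: contraTneq uU => ->; rewrite inE ?xC ?yC).
  - by apply: contraTneq vU => ->; rewrite inE xC.
  - by apply: contraTneq vU => ->; rewrite inE yC.
  - by apply: contraTneq xy => ->; rewrite adj_irrefl.
have [ux' uy' vx' vy' xy'] := ne.
have nC w : w \in U -> w \notin cover M0 by rewrite coverM0 inE => /negPf->.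
have [mM1 cM1] : matching ([set v; y] |: M0) /\ #|[set v; y] |: M0| = #|M0|.+1.
  by apply: matchingU1 => //; [apply: nC | rewrite coverM0 set22 andbF].
have cover1 w : w \in cover ([set v; y] |: M0) -> [|| w == v, w == y | w \in cover M0].
  move=> /bigcupP[E]; rewrite in_setU1 => /orP[/eqP->|EM wE].
    by rewrite !inE => /orP[->|->]; rewrite ?orbT.
  by apply/or3P/Or33/bigcupP; exists E.
pose D := [set u; x] |: ([set v; y] |: M0).
have [mD cD] : matching D /\ #|D| = #|[set v; y] |: M0|.+1.
  apply: matchingU1 => //.
    by apply/negP=> /cover1; rewrite (negPf uv) (negPf uy') (negPf (nC u uU)).
  by apply/negP=> /cover1; rewrite coverM0 set21 andbF orbF eq_sym (negPf vx') (negPf xy').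
have nconn : ~~ k_connected k (del_edges D).
  apply/negP=> conn; have := @maxM D.
  by rewrite /k_removable mD conn cD cM1 cM0 eqxx => /(_ isT).
have [A [B [a [b [aA bB dAB inD ltk]]]]] := not_k_connected_del card_k nconn.
have inD' p q : (p \in A) && (q \in B) || (p \in B) && (q \in A) -> adj p q ->
    [set p; q] \in D.
  case/orP=> /andP[pA qB] pq; first exact: inD.
  by rewrite setUC inD // adj_sym.
have nxy : [set x; y] \notin D.
  apply/negP; rewrite !inE eqxx /= orbF => /orP[] /eqP/set2_inj[] [E1 E2].
  - by rewrite -E1 eqxx in ux'.
  - by rewrite -E2 eqxx in uy'.
  - by rewrite -E1 eqxx in vx'.
  - by rewrite -E2 eqxx in vy'.
have nuy : [set u; y] \notin D.
  apply/negP; rewrite !inE => /or3P[/eqP/set2_inj[] [E1 E2]|/eqP/set2_inj[] [E1 E2]|].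
  - by rewrite E2 eqxx in xy'.
  - by rewrite E1 eqxx in ux'.
  - by rewrite E1 eqxx in uv.
  - by rewrite E1 eqxx in uy'.
  - by case/andP=> _ uyM; have := uU; rewrite inE => /coverP[] //; exists y.
have nvx : [set v; x] \notin D.
  apply/negP; rewrite !inE => /or3P[/eqP/set2_inj[] [E1 E2]|/eqP/set2_inj[] [E1 E2]|].
  - by rewrite E1 eqxx in uv.
  - by rewrite E1 eqxx in vx'.
  - by rewrite E2 eqxx in xy'.
  - by rewrite E1 eqxx in vy'.
  - by case/andP=> _ vxM; have := vU; rewrite inE => /coverP[] //; exists x.
(* M - xy + ux is removable, so some edge outside it crosses the small cut, and only [vy] is left.
   The other replacement gives [ux] in the same way. *)
have vyAB : (v \in A) && (y \in B) || (v \in B) && (y \in A).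
  have [p [q [pA qB pq npq]]] := crossing conn1 aA bB dAB ltk.
  have : [set p; q] \in D by exact: inD.
  move: npq; rewrite /D !in_setU1 negb_or => /andP[/negPf-> /negPf->]; rewrite orbF /=.
  by case/eqP/set2_inj=> -[<- <-]; rewrite pA qB ?orbT.
have uxAB : (u \in A) && (x \in B) || (u \in B) && (x \in A).
  have [p [q [pA qB pq npq]]] := crossing conn2 aA bB dAB ltk.
  have : [set p; q] \in D by exact: inD.
  move: npq; rewrite in_setU1 /D setUCA in_setU1 negb_or => /andP[/negPf-> /negPf nq].
  rewrite in_setU1 nq orbF /=.
  by case/eqP/set2_inj=> -[<- <-]; rewrite pA qB ?orbT.
have := inD' x y; have := inD' u y; have := inD' v x.
rewrite xy (negPf nxy) (negPf nuy) (negPf nvx).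
case/orP: vyAB => /andP[-> ->]; case/orP: uxAB => /andP[-> ->];
  rewrite /= ?orbT => h1 h2 h3;
  by [exact: (notF (h3 isT isT)) | case/orP: uyvx => [/(h2 isT)|/(h1 isT)]].
Qed.

(* If u x is blocked, two leaves of the part of U in B can be used instead of u. *)
Let blocked_exchange u x y : u \in U -> leafy u -> [set x; y] \in M -> adj u x ->
  blocked u x y -> False.
Proof.
move=> uU lu xyM ux blocked_u.
have xC : x \in C by apply/coverP => //; exists y.
have yC : y \in C by apply/coverP => //; exists x; rewrite setUC.
have [A [B [cAB /subsetP UAB Q_gt1 Q_gt0 leafQ]]] := blocked_sep xyM ux uU lu blocked_u.
set Q := B :&: U in Q_gt1 Q_gt0 leafQ.
have QU : Q \subset U by apply: subsetIr.
(* Only [ux] crosses the separation and [x] is covered, so vertices of [Q] have no neighbours in [U]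
   outside [Q]. *)
have leafyQ w : w \in Q -> degree_in (@adj G) Q w <= 1 -> leafy w.
  rewrite inE => /andP[wB wU]; apply: leq_trans; apply/subset_leq_card/subsetP=> v.
  rewrite !inE => /andP[vU wv]; rewrite wv vU !andbT.
  have := UAB v; rewrite !inE vU => /(_ isT)/orP[vA|//].
  have [_ _ _ /(_ v w vA wB) AB _] := cAB.
  have [|_ wx] := AB; first by rewrite r_sym rU.
  by rewrite wx inE xC in wU.
(* A second blocking separation would have [w] and its neighbours in [Q] on the side [A']. The
   forest on [A' :&: Q] has a leaf [z] other than [w]; it is a leaf of [Q], hence adjacent to [x'],
   but only [wx'] may cross. *)
have not_blocked w x' y' : w \in Q -> degree_in (@adj G) Q w <= 1 -> [set x'; y'] \in M ->
    {in Q, forall z, degree_in (@adj G) Q z <= 1 -> adj z x'} -> ~~ blocked w x' y'.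
  move=> wQ le1 xyM' adjx; apply/negP=> blocked_w.
  have wU := subsetP QU w wQ.
  have x'C : x' \in C by apply/coverP => //; exists y'.
  have [A' [B' [cAB' /subsetP UAB' _ _ _]]] :=
    blocked_sep xyM' (adjx w wQ le1) wU (leafyQ w wQ le1) blocked_w.
  have [wA' x'B' _ AB' _] := cAB'.
  have UA' z v : z \in A' -> z \in U -> v \in U -> adj z v -> v \in A'.
    move=> zA' zU vU zv; have := UAB' v vU; rewrite inE => /orP[//|vB'].
    have [_ vx'] := AB' z v zA' vB' (etrans (rU _ zU) zv).
    by rewrite vx' inE x'C in vU.
  pose P := A' :&: Q.
  have PU : P \subset U by apply: subset_trans QU; apply: subsetIr.
  have P_gt1 : 1 < #|P|.
    have /degree_in_gt0[v vQ wv] := Q_gt0 w wQ.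
    apply/card_gt1P; exists w, v; split.
    - by rewrite inE wA'.
    - by rewrite inE vQ andbT; apply: (UA' w) => //; apply: (subsetP QU).
    - by apply: contraTneq wv => ->; rewrite adj_irrefl.
  have [z [zP zw lz]] : exists z, [/\ z \in P, z != w & degree_in (@adj G) P z <= 1].
    have [z1 [z2 [z1P z2P z12 l1 l2]]] := two_leaves PU P_gt1.
    have [z1w|z1w] := eqVneq z1 w; last by exists z1.
    by exists z2; split=> //; rewrite -z1w eq_sym.
  have := zP; rewrite inE => /andP[zA' zQ]; have zU := subsetP QU z zQ.
  have lzQ : degree_in (@adj G) Q z <= 1.
    apply: leq_trans lz; apply/subset_leq_card/subsetP=> v; rewrite [v \in _]inE => /andP[vQ zv].
    rewrite [v \in _]inE [v \in P]in_setI vQ zv !andbT.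
    by apply: (UA' z) => //; apply: (subsetP QU).
  have [zw' _] := AB' z x' zA' x'B' (etrans (rU _ zU) (adjx z zQ lzQ)).
  by rewrite zw' eqxx in zw.
have [w1 [w2 [w1Q w2Q w12 l1 l2]]] := two_leaves QU Q_gt1.
have [w1x w1y] := leafQ w1 w1Q l1; have [w2x w2y] := leafQ w2 w2Q l2.
apply: (@exchange w1 w2 x y) => //; rewrite ?(subsetP QU) ?w1y //.
  by apply: not_blocked => // z zQ lz; have [] := leafQ z zQ lz.
by apply: not_blocked; rewrite // 1?setUC // => z zQ lz; have [] := leafQ z zQ lz.
Qed.


(* The side of the cut produced by deleting ax and by that avoids x and y. *)
Let cut_pair x y a b : k = 1 -> M = [set [set x; y]] ->
    {in U, forall z, leafy z -> adj z x || adj z y} ->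
    a \in U -> b \in U -> a != b -> adj a x -> adj b y ->
  exists A, [/\ A \subset U, a \in A, b \in A &
    {in A & ~: A, forall p q, adj p q -> (p = a /\ q = x) \/ (p = b /\ q = y)}].
Proof.
move=> k1 ME leaf_adj aU bU ab ax by_.
have xyM : [set x; y] \in M by rewrite ME set11.
have CE z : (z \in C) = (z \in [set x; y]) by rewrite /C ME /cover big_set1.
have xC : x \in C by rewrite CE set21.
have yC : y \in C by rewrite CE set22.
have xy : adj x y := matching_adj mM xyM.
have xy' : x != y by apply: contraTneq xy => ->; rewrite adj_irrefl.
have UC p q : p \in U -> q \in C -> p != q.
  by move=> pU qC; apply: contraTneq pU => ->; rewrite inE qC.
pose D := [set a; x] |: ([set b; y] |: set0).
have cover0 z : (z \in cover (set0 : {set {set G}})) = false by rewrite /cover big_set0 inE.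
have [mD0 cD0] : matching ([set b; y] |: set0) /\
    #|[set b; y] |: set0| = #|set0 : {set {set G}}|.+1.
  apply: matchingU1; rewrite ?cover0 //.
  by rewrite /matching sub0set; apply/trivIsetP => E F; rewrite inE.
have [mD cD] : matching D /\ #|D| = 2.
  rewrite /D; have [] // := matchingU1 mD0 ax.
  - by rewrite setU0 /cover big_set1 !inE negb_or ab UC.
  - by rewrite setU0 /cover big_set1 !inE negb_or xy' eq_sym UC.
  by rewrite cD0 cards0.
have nconn : ~~ k_connected k (del_edges D).
  apply/negP=> conn; have := @maxM D.
  by rewrite /k_removable mD conn cD ME cards1 eqxx => /(_ isT).
have [A0 [B0 [a0 [b0 [aA bB dAB inD]]]]] := not_k_connected_del card_k nconn.
(* For k = 1 the separator is empty and the two sides partition the graph. *)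
rewrite k1 ltnS leqn0 cards_eq0 => /eqP AB0.
have ABC z : (z \in B0) = (z \notin A0).
  have := disjointF dAB z; move/setP/(_ z): AB0; rewrite !inE.
  by case: (z \in A0); case: (z \in B0).
have crossD p q : (p \in A0) != (q \in A0) -> adj p q ->
    [\/ p = a /\ q = x, p = x /\ q = a, p = b /\ q = y | p = y /\ q = b].
  move=> pq apq; have : [set p; q] \in D.
    case: (boolP (p \in A0)) pq => pA; case: (boolP (q \in A0)) => // qA _.
      by rewrite inD // ABC.
    by rewrite setUC inD // ?ABC // adj_sym.
  rewrite /D setU0 in_setU1 inE => /orP[] /eqP/set2_inj[].
  - by constructor 1.
  - by constructor 2.
  - by constructor 3.
  - by constructor 4.
have sidexy : (x \in A0) = (y \in A0).
  apply/eqP/negPn/negP=> /crossD/(_ xy)[] [E1 E2].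
  - by have := UC a x aU xC; rewrite E1 eqxx.
  - by have := UC a y aU yC; rewrite E2 eqxx.
  - by have := UC b x bU xC; rewrite E1 eqxx.
  - by rewrite E1 eqxx in xy'.
pose A := [set z | (z \in A0) != (x \in A0)].
have AU : A \subset U.
  apply/subsetP=> z; rewrite !inE CE; apply: contraNN.
  by rewrite !inE => /orP[]/eqP->; rewrite // sidexy.
have cross : {in A & ~: A, forall p q, adj p q -> (p = a /\ q = x) \/ (p = b /\ q = y)}.
  move=> p q pA; have pU := subsetP AU p pA; move: pA; rewrite !inE negbK => px /eqP qx pq.
  have [||[E1 _]||[E1 _]] := crossD p q _ pq; rewrite ?qx //; auto.
    by have := UC p x pU xC; rewrite E1 eqxx.
  by have := UC p y pU yC; rewrite E1 eqxx.
have [p pA] : exists p, p \in A.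
  have [xA|xA] := boolP (x \in A0).
    by rewrite ABC in bB; exists b0; rewrite inE xA (negPf bB).
  by exists a0; rewrite inE aA (negPf xA).
have A_gt1 : 1 < #|A|.
  have /card_gt1P[q1 [q2 [+ + q12]]] : 1 < degree p by have := deg_k p; rewrite k1.
  rewrite !inE => pq1 pq2.
  have [q [qA pq]] : exists q, q \in A /\ adj p q.
    have [q1A|q1A] := boolP (q1 \in A); first by exists q1.
    have [q2A|q2A] := boolP (q2 \in A); first by exists q2.
    have := cross p q1 pA; rewrite inE => /(_ q1A pq1).
    have := cross p q2 pA; rewrite inE => /(_ q2A pq2).
    move=> [] [E1 E2] [] [E3 E4].
    - by rewrite E2 E4 eqxx in q12.
    - by rewrite -E1 -E3 eqxx in ab.
    - by rewrite -E1 -E3 eqxx in ab.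
    - by rewrite E2 E4 eqxx in q12.
  apply/card_gt1P; exists p, q; split=> //.
  by apply: contraTneq pq => ->; rewrite adj_irrefl.
(* No edge leaves [A] within [U], so a leaf of [A] is a leaf of [U]. It is adjacent to [x] or [y],
   and this edge crosses. The two leaves of [A] are therefore [a] and [b]. *)
have leafA z : z \in A -> degree_in (@adj G) A z <= 1 -> z = a \/ z = b.
  move=> zA lz; have zU := subsetP AU z zA.
  have xA : x \in ~: A by rewrite !inE eqxx.
  have yA : y \in ~: A by rewrite !inE sidexy eqxx.
  have : leafy z.
    apply: leq_trans lz; apply/subset_leq_card/subsetP=> q; rewrite [q \in _]inE => /andP[qU zq].
    rewrite [q \in _]inE zq andbT; apply/negPn/negP=> qA.
    have := cross z q zA; rewrite inE => /(_ qA zq)[] [_ qE].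
      by have := UC q x qU xC; rewrite qE eqxx.
    by have := UC q y qU yC; rewrite qE eqxx.
  move=> /(leaf_adj z zU)/orP[] zxy.
    by have [[->]|[->]] := cross z x zA xA zxy; auto.
  by have [[->]|[->]] := cross z y zA yA zxy; auto.
have [z1 [z2 [z1A z2A z12 l1 l2]]] := two_leaves AU A_gt1.
exists A; split=> //.
  case: (leafA z1 z1A l1) => [<-//|z1b]; case: (leafA z2 z2A l2) => [<-//|z2b].
  by rewrite z1b z2b eqxx in z12.
case: (leafA z1 z1A l1) => [z1a|<-//]; case: (leafA z2 z2A l2) => [z2a|<-//].
by rewrite z1a z2a eqxx in z12.
Qed.


(** Two neighbours [a] and [a'] of [x] give two cuts, each avoiding the other neighbour. Their
    intersection contains [b] and has a leaf other than [b]; this leaf is adjacent to [x] or [y],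
    hence would have to be [a] or [b]. *)
Let unique_neighbour x y a a' b : k = 1 -> M = [set [set x; y]] ->
    {in U, forall z, leafy z -> adj z x || adj z y} ->
    a \in U -> b \in U -> a != b -> adj a x -> adj b y ->
  a' \in U -> adj a' x -> a' = a.
Proof.
move=> k1 ME leaf_adj aU bU ab ax by_ a'U a'x.
have CE z : (z \in C) = (z \in [set x; y]) by rewrite /C ME /cover big_set1.
have xC : x \in C by rewrite CE set21.
have yC : y \in C by rewrite CE set22.
have xy : x != y.
  have : adj x y by apply: (matching_adj mM); rewrite ME set11.
  by apply: contraTneq => ->; rewrite adj_irrefl.
apply/eqP/negPn/negP=> a'a.
have [A [AU aA bA crossA]] := cut_pair k1 ME leaf_adj aU bU ab ax by_.
have nA A' q : A' \subset U -> q \in C -> q \in ~: A'.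
  by move=> /subsetP A'U qC; rewrite inE; apply/negP=> /A'U; rewrite inE qC.
have a'A : a' \notin A.
  apply/negP=> a'A; case: (crossA a' x a'A (nA A x AU xC) a'x) => [] [E1 E2].
    by rewrite E1 eqxx in a'a.
  by rewrite E2 eqxx in xy.
have a'b : a' != b by apply: contraNneq a'A => ->.
have [A' [A'U a'A' bA' crossA']] := cut_pair k1 ME leaf_adj a'U bU a'b a'x by_.
have aA' : a \notin A'.
  apply/negP=> aA'; case: (crossA' a x aA' (nA A' x A'U xC) ax) => [] [E1 E2].
    by rewrite E1 eqxx in a'a.
  by rewrite E2 eqxx in xy.
pose P := A :&: A'.
have PU : P \subset U by apply: subset_trans AU; apply: subsetIl.
have bx : ~~ adj b x.
  apply/negP=> bx; case: (crossA b x bA (nA A x AU xC) bx) => [] [E1 E2].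
    by rewrite E1 eqxx in ab.
  by rewrite E2 eqxx in xy.
have P_gt1 : 1 < #|P|.
  have /card_gt1P[q1 [q2 [+ + q12]]] : 1 < degree b by have := deg_k b; rewrite k1.
  rewrite !inE => bq1 bq2.
  have [q [qy bq]] : exists q, q != y /\ adj b q.
    have [q1y|q1y] := eqVneq q1 y; last by exists q1.
    by exists q2; split=> //; rewrite -q1y eq_sym.
  apply/card_gt1P; exists b, q; split.
  - by rewrite inE bA.
  - rewrite inE; apply/andP; split; apply/negPn/negP=> nq.
      have := crossA b q bA; rewrite inE => /(_ nq bq)[] [E1 E2].
        by rewrite E1 eqxx in ab.
      by rewrite E2 eqxx in qy.
    have := crossA' b q bA'; rewrite inE => /(_ nq bq)[] [E1 E2].
      by rewrite E1 eqxx in a'b.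
    by rewrite E2 eqxx in qy.
  - by apply: contraTneq bq => ->; rewrite adj_irrefl.
have [z [zP zb lz]] : exists z, [/\ z \in P, z != b & degree_in (@adj G) P z <= 1].
  have [z1 [z2 [z1P z2P z12 l1 l2]]] := two_leaves PU P_gt1.
  have [z1b|z1b] := eqVneq z1 b; last by exists z1.
  by exists z2; split=> //; rewrite -z1b eq_sym.
have zU := subsetP PU z zP; move: zP; rewrite inE => /andP[zA zA'].
have in_side A0 c d q : A0 \subset U -> {in A0 & ~: A0, forall p q, adj p q ->
    (p = c /\ q = x) \/ (p = d /\ q = y)} -> z \in A0 -> q \in U -> adj z q -> q \in A0.
  move=> A0U cross zA0 qU zq; apply/negPn/negP=> nq.
  have := cross z q zA0; rewrite inE => /(_ nq zq)[] [_ E].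
    by rewrite E inE xC in qU.
  by rewrite E inE yC in qU.
have : leafy z.
  apply: leq_trans lz; apply/subset_leq_card/subsetP=> q; rewrite [q \in _]inE => /andP[qU zq].
  rewrite [q \in _]inE zq andbT [q \in P]in_setI.
  by rewrite (in_side _ _ _ _ AU crossA) // (in_side _ _ _ _ A'U crossA').
case/(leaf_adj z zU)/orP=> [zx|zy].
  case: (crossA z x zA (nA A x AU xC) zx) => [] [E1 E2].
    by rewrite -E1 zA' in aA'.
  by rewrite E2 eqxx in xy.
case: (crossA z y zA (nA A y AU yC) zy) => [] [E1 E2].
  by rewrite E2 eqxx in xy.
by rewrite E1 eqxx in zb.
Qed.

(** [x] and [y] have unique neighbours [a] and [b] in [U], so the degrees in [U] sum to at most the
    forest sum plus 2, that is 2|U|. As all degrees are at least 2, none is larger. *)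
Let degree_le2 x y : k = 1 -> M = [set [set x; y]] ->
    (exists u v, [/\ u \in U, v \in U, u != v, leafy u & leafy v]) ->
    {in U, forall z, leafy z -> adj z x (+) adj z y} ->
  forall z : G, degree z <= 2.
Proof.
move=> k1 ME [u [v [uU vU uv lu lv]]] leaf_xor.
have xyM : [set x; y] \in M by rewrite ME set11.
have CE : C = [set x; y] by rewrite /C ME /cover big_set1.
have xC : x \in C by rewrite CE set21.
have yC : y \in C by rewrite CE set22.
have xy : x != y.
  have : adj x y by apply: (matching_adj mM).
  by apply: contraTneq => ->; rewrite adj_irrefl.
have leaf_adj : {in U, forall z, leafy z -> adj z x || adj z y}.
  by move=> z zU /(leaf_xor z zU); case: (adj z x).
have leaf_adj' : {in U, forall z, leafy z -> adj z y || adj z x}.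
  by move=> z zU lz; rewrite orbC leaf_adj.
have nbrU p q : p \in C -> q \in C -> C = [set p; q] -> exists2 a, a \in U & adj a p.
  move=> pC qC CE'.
  have /card_gt1P[a1 [a2 [+ + a12]]] : 1 < degree p by have := deg_k p; rewrite k1.
  rewrite !inE => pa1 pa2.
  have nbr a : a != q -> adj p a -> exists2 a, a \in U & adj a p.
    move=> aq pa; exists a; last by rewrite adj_sym.
    rewrite in_setC CE' !inE negb_or aq andbT.
    by apply: contraTneq pa => ->; rewrite adj_irrefl.
  have [a1q|/nbr-/(_ pa1)//] := eqVneq a1 q.
  by apply: (nbr a2); rewrite // -a1q eq_sym.
have [a [b [aU bU ab ax by_]]] : exists a b, [/\ a \in U, b \in U, a != b, adj a x & adj b y].
  have [a aU ax] := nbrU x y xC yC CE.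
  have [|b bU by_] := nbrU y x yC xC; first by rewrite setUC.
  have [ab|ab] := eqVneq a b; last by exists a, b.
  subst b.
  (* If [a] was found for both ends, a second leaf replaces it at one of them. *)
  have [w [wU wa lw]] : exists w, [/\ w \in U, w != a & leafy w].
    have [ua|ua] := eqVneq u a; last by exists u.
    by exists v; split; rewrite // -ua eq_sym.
  case/orP: (leaf_adj w wU lw) => [wx|wy]; first by exists w, a.
  by exists a, w; rewrite eq_sym.
have ME' : M = [set [set y; x]] by rewrite setUC.
have uniq_x z : z \in U -> adj z x -> z = a.
  by move=> zU zx; apply: (unique_neighbour (a := a) (b := b) k1 ME leaf_adj).
have uniq_y z : z \in U -> adj z y -> z = b.
  move=> zU zy; apply: (unique_neighbour (a := b) (b := a) k1 ME' leaf_adj') => //.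
  by rewrite eq_sym.
have degU z : z \in U -> degree z <= degree_in (@adj G) U z + ((z == a) + (z == b)).
  move=> zU; rewrite degree_split leq_add2l.
  have -> : #|[set w in C | adj z w]| = degree_in (@adj G) [set x; y] z by rewrite CE.
  rewrite (degree_inD1 (@adj G) z (set21 x y)).
  have yxy : y \in [set x; y] :\ x by rewrite !inE eqxx orbT eq_sym xy.
  rewrite (degree_inD1 (@adj G) z yxy).
  have -> : degree_in (@adj G) ([set x; y] :\ x :\ y) z = 0.
    by apply: eq_card0 => w; rewrite !inE; case: (w == x); case: (w == y).
  rewrite addn0; apply: leq_add.
    by case: (boolP (adj z x)) => // /(uniq_x z zU) ->; rewrite eqxx.
  by case: (boolP (adj z y)) => // /(uniq_y z zU) ->; rewrite eqxx.
have degC p q c : C = [set p; q] -> {in U, forall z, adj z p -> z = c} -> degree p <= 2.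
  move=> CE' uniq; apply: leq_trans (_ : #|[set c; q]| <= 2); last first.
    by rewrite cards2; case: (c != q).
  apply/subset_leq_card/subsetP=> w; rewrite !inE => pw.
  have [wC|wC] := boolP (w \in C); last first.
    by rewrite (uniq w) ?eqxx ?inE // adj_sym.
  move: wC; rewrite CE' !inE => /orP[/eqP wp|->]; last by rewrite orbT.
  by rewrite wp adj_irrefl in pw.
move=> z; have [|zC] := boolP (z \in C).
  rewrite [in z \in _]CE => /set2P[]->; first exact: (degC x y a).
  by apply: (degC y x b) => //; rewrite setUC.
have zU : z \in U by rewrite inE.
rewrite leqNgt; apply/negP=> deg_z.
have U0 : U != set0 by apply/set0Pn; exists z.
have := forest_degree_sum (@adj_sym G) (@adj_irrefl G) forestU (subxx U) U0.
have one c : c \in U -> \sum_(w in U) (w == c) = 1.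
  by move=> cU; rewrite (big_setD1 c) //= eqxx big1 // => w /setD1P[/negPf->].
have : \sum_(w in U) (2 + (w == z)) <=
    \sum_(w in U) (degree_in (@adj G) U w + ((w == a) + (w == b))).
  apply: leq_sum => w wU; apply: leq_trans (degU w wU).
  by have [->//|_] := eqVneq w z; rewrite addn0; have := deg_k w; rewrite k1.
rewrite !big_split /= !one // sum_nat_const; clear; lia.
Qed.

(** Two uncovered vertices yield two leaves. A leaf adjacent to both ends of an edge of [M] would
    allow an exchange, so it misses one end of each edge. It misses at most one covered vertex,
    whence |M| = 1, and k < 2|M| gives k = 1. *)
Lemma larger_removable_matching : 2 * #|M|.+1 <= #|G| ->
  [/\ k = 1, #|M| = 1 & forall x : G, degree x <= 2].
Proof.
move=> cG; have U_gt1 : 1 < #|U|.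
  by move: cG; rewrite -(cardsC C) card_cover // /U; clear; lia.
have [u [v [uU vU uv lu lv]]] := two_leaves (subxx U) U_gt1.
have lt_k := leafy_bound uU lu.
have not_blocked w x y : w \in U -> leafy w -> [set x; y] \in M -> adj w x -> ~~ blocked w x y.
  by move=> wU lw xyM wx; apply/negP; apply: blocked_exchange.
have no_pair w z x y : w \in U -> z \in U -> leafy w -> leafy z -> w != z ->
    [set x; y] \in M -> adj w x -> adj w y -> False.
  move=> wU zU lw lz wz xyM wx wy.
  have yxM : [set y; x] \in M by rewrite setUC.
  have [zy|zy] := boolP (adj z y).
    by apply: (exchange wU zU wz xyM wx zy); rewrite ?wy // not_blocked.
  have zx : adj z x.
    apply/negPn/negP=> zx; have := matching_adj mM xyM.
    suff -> : x = y by rewrite adj_irrefl.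
    apply: (nonneighbour_unique lz) => //; first by apply/coverP => //; exists y.
    by apply/coverP => //; exists x.
  by apply: (exchange wU zU wz yxM wy zx); rewrite ?wx // not_blocked.
have M_gt0 : 0 < #|M| by move: lt_k; clear; lia.
have misses w z x y : w \in U -> z \in U -> leafy w -> leafy z -> w != z ->
    [set x; y] \in M -> adj w x (+) adj w y.
  move=> wU zU lw lz wz xyM; have := no_pair w z x y wU zU lw lz wz xyM.
  have xC : x \in C by apply/coverP => //; exists y.
  have yC : y \in C by apply/coverP => //; exists x; rewrite setUC.
  have := nonneighbour_unique lw xC yC.
  case: (adj w x) (adj w y) => [] [] //=; first by move=> _ /(_ isT isT).
  move=> /(_ isT isT) xy; have := matching_adj mM xyM.
  by rewrite xy adj_irrefl.
have edgeE E : E \in M -> exists x y, E = [set x; y].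
  by case/andP: mM => /subsetP sub _ /sub/imsetP[[x y] _ ->]; exists x, y.
have M1 : #|M| = 1.
  apply/eqP; rewrite eqn_leq M_gt0 andbT; apply: contraT; rewrite -ltnNge.
  case/card_gt1P=> E1 [E2 [E1M E2M E12]].
  have miss E : E \in M -> exists p, [/\ p \in E, p \in C & ~~ adj u p].
    move=> EM; have [x [y Exy]] := edgeE E EM; rewrite Exy in EM *.
    have xC : x \in C by apply/coverP => //; exists y.
    have yC : y \in C by apply/coverP => //; exists x; rewrite setUC.
    have := misses u v x y uU vU lu lv uv EM.
    case: (boolP (adj u x)) => [_ /= uy|ux _]; first by exists y; rewrite set22.
    by exists x; rewrite set21.
  have [p1 [p1E p1C np1]] := miss E1 E1M; have [p2 [p2E p2C np2]] := miss E2 E2M.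
  have E := nonneighbour_unique lu p1C p2C np1 np2.
  have /andP[_ /trivIsetP/(_ E1 E2 E1M E2M E12)/disjointF/(_ p1)] := mM.
  by rewrite p1E E p2E.
have k1 : k = 1 by move: lt_k k_gt0; rewrite M1; clear; lia.
split=> //; have /cards1P[E ME] : #|M| == 1 by rewrite M1.
have EM : E \in M by rewrite ME set11.
have [x [y Exy]] := edgeE E EM; rewrite Exy in ME.
apply: (degree_le2 (x := x) (y := y) k1 ME); first by exists u, v.
move=> z zU lz; have xyM : [set x; y] \in M by rewrite ME set11.
have [zu|zu] := eqVneq z u; first by rewrite zu; apply: (misses u v).
exact: (misses z u).
Qed.

End Exchange.

(** * Recognizing complete graphs and cycles *)

Lemma min_degree_le (G : sgraph) (x : G) : min_degree G <= degree x.
Proof.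
rewrite /min_degree; have : x \in index_enum G by apply: mem_index_enum.
elim: (index_enum G) => // y s IHs; rewrite inE big_cons.
by case/orP=> [/eqP<-|/IHs le]; rewrite geq_min ?leqnn // le orbT.
Qed.

Lemma degree_lt_card (G : sgraph) (x : G) : degree x < #|G|.
Proof.
rewrite -cardsT; apply: proper_card; apply/properP; split; first exact: subsetT.
by exists x; rewrite ?inE ?adj_irrefl.
Qed.

Lemma complete_graph_iso (G : sgraph) n : #|G| = n ->
  (forall x : G, n.-1 <= degree x) -> graph_iso G (complete_graph n).
Proof.
move=> cG degG; exists (fun x : G => cast_ord cG (enum_rank x)).
  exists (fun i => enum_val (cast_ord (esym cG) i)) => [x|i].
    by rewrite cast_ordK enum_rankK.
  by rewrite enum_valK cast_ordKV.
move=> x y; rewrite -[LHS]/(cast_ord cG (enum_rank x) != cast_ord cG (enum_rank y)).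
rewrite (inj_eq (@cast_ord_inj _ _ _)) (inj_eq enum_rank_inj).
(* The neighbourhood lies in the complement of [x] and has at least its size. *)
have /setP/(_ y) : [set z | adj x z] = [set~ x]; last by rewrite !inE eq_sym.
apply/eqP; rewrite eqEcard cardsC1 cG degG andbT; apply/subsetP=> z; rewrite !inE.
by apply: contraTneq => ->; rewrite adj_irrefl.
Qed.

(** The path is extended at its head; the induction stops because a simple path has at most |G|
    vertices. *)
Lemma head_maximal_path (G : sgraph) : 0 < #|G| -> exists (x : G) (p : seq G),
  [/\ path (@adj G) x p, uniq (x :: p) & forall y, adj x y -> y \in x :: p].
Proof.
case/card_gt0P=> x0 _.
suff ext n (x : G) (p : seq G) : #|G| - size p <= n -> path (@adj G) x p -> uniq (x :: p) ->
    exists (x : G) (p : seq G),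
      [/\ path (@adj G) x p, uniq (x :: p) & forall y, adj x y -> y \in x :: p].
  exact: (ext _ x0 [::] (leqnn _)).
elim: n x p => [|n IHn] x p ltn xp up.
  have := max_card (mem (x :: p)); rewrite (card_uniqP up) /= ltnNge.
  by rewrite leqn0 subn_eq0 in ltn; rewrite ltn.
have [/existsP[y /andP[xy yp]]|/existsPn nex] := 
    boolP [exists y, adj x y && (y \notin x :: p)].
  apply: (IHn y (x :: p)); rewrite ?cons_uniq ?yp ?up //=; last by rewrite adj_sym xy.
  by rewrite subnS -subn1 leq_subLR add1n.
exists x, p; split=> // y xy; apply/negPn/negP=> yp.
by have := nex y; rewrite xy yp.
Qed.

Lemma cycle_of_degree2 (G : sgraph) : 0 < #|G| -> (forall x : G, degree x = 2) ->
  exists c : seq G, [/\ cycle (@adj G) c, uniq c & 2 < size c].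
Proof.
move=> G_gt0 deg2; have [x [p [xp up Nx]]] := head_maximal_path G_gt0.
have [z1 [z2 [+ + z12]]] : exists z1 z2, [/\ z1 \in [set y | adj x y],
    z2 \in [set y | adj x y] & z1 != z2].
  by apply/card_gt1P; have := deg2 x; rewrite /degree => ->.
rewrite !inE => xz1 xz2.
case: p xp up Nx => [|y p]; rewrite /=.
  move=> _ _ /(_ z1 xz1); rewrite inE => /eqP E.
  by rewrite E adj_irrefl in xz1.
move=> /andP[xy yp] up Nx.
have [z [xz zy]] : exists z, adj x z /\ z != y.
  have [z1y|z1y] := eqVneq z1 y; last by exists z1.
  by exists z2; split=> //; rewrite -z1y eq_sym.
(* The second neighbour of the head lies on the path beyond [y], which closes a cycle of length at
   least 3. *)
have zp : z \in p.
  have := Nx z xz; rewrite !inE (negPf zy) /= => /orP[/eqP zx|//].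
  by rewrite zx adj_irrefl in xz.
case/splitPr: zp yp up {Nx} => p1 p2; rewrite cat_path /= => /and3P[yp1 p1z _].
rewrite -cat_rcons => up; exists (x :: y :: rcons p1 z); split.
- rewrite /= xy rcons_path rcons_path yp1 p1z /= last_rcons.
  by rewrite adj_sym xz.
- have : uniq ((x :: y :: rcons p1 z) ++ p2) := up.
  by rewrite cat_uniq => /and3P[].
- by rewrite /= size_rcons.
Qed.

Lemma ordS_neq_ord_pred n (i : 'I_n) : 2 < n -> ordS i != ord_pred i.
Proof.
move=> n_gt2; apply/eqP=> /(congr1 (@ordS n)); rewrite ord_predK.
case: i => j ltj /(congr1 val) /=.
have [ltj2|lej2] := ltnP j.+2 n.
  by rewrite (modn_small (ltnW ltj2)) (modn_small ltj2); clear; lia.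
have [ltj1|lej1] := ltnP j.+1 n.
  rewrite (modn_small ltj1) (_ : j.+2 = n) ?modnn; last by apply/eqP; rewrite eqn_leq ltj1 lej2.
  by move=> j0; move: lej2 n_gt2; rewrite -j0; clear; lia.
have -> : j.+1 = n by apply/eqP; rewrite eqn_leq ltj lej1.
rewrite modnn (modn_small (ltnW n_gt2)) => j1.
by move: lej1 n_gt2; rewrite -j1; clear; lia.
Qed.

(** The cycle found uses up both neighbours of each of its vertices, so no edge leaves it and
    connectedness makes it spanning. *)
Lemma is_cycle_of_degree2 (G : sgraph) : 0 < #|G| -> (forall x : G, degree x = 2) ->
  (forall x y : G, connect (@adj G) x y) -> is_cycle G.
Proof.
move=> G_gt0 deg2 conn; have [c [cyc uc c_gt2]] := cycle_of_degree2 G_gt0 deg2.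
have [x0 x0c] : exists x, x \in c by case: c c_gt2 {cyc uc} => // x c _; exists x; rewrite inE eqxx.
pose g (i : 'I_(size c)) := nth x0 c i.
have adjS i : adj (g i) (g (ordS i)).
  case: c @g cyc i {uc x0c c_gt2} => [|y s] g /=; first by move=> _ [].
  move=> /(pathP x0) step [i lti]; have := step i; rewrite size_rcons => /(_ lti).
  rewrite /g /= -rcons_cons nth_rcons lti nth_rcons.
  move: lti; rewrite ltnS leq_eqVlt => /orP[/eqP->|lti].
    by rewrite ltnn eqxx modnn.
  by rewrite lti modn_small.
have g_inj : injective g.
  by move=> i j /eqP; rewrite nth_uniq // => /eqP/val_inj.
have nbrs i : [set v | adj (g i) v] = [set g (ordS i); g (ord_pred i)].
  apply/esym/eqP; rewrite eqEcard subUset !sub1set !inE adjS /=.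
  have := deg2 (g i); rewrite /degree => ->.
  rewrite cards2 (inj_eq g_inj) ordS_neq_ord_pred // andbT.
  by rewrite adj_sym -{2}[i]ord_predK adjS.
have g_surj y : exists i, g i = y.
  have x0i : exists i, g i = x0.
    by exists (Ordinal (etrans (index_mem _ _) x0c)); rewrite /g /= nth_index.
  have /connectP[p] := conn x0 y; elim: p (x0) x0i => [|z p IHp] x [i gi] /=.
    by move=> _ ->; exists i.
  move=> /andP[xz xp]; apply: IHp => //.
  have : z \in [set v | adj (g i) v] by rewrite inE gi.
  by rewrite nbrs => /set2P[] ->; [exists (ordS i) | exists (ord_pred i)].
have [f fK gK] : bijective g.
  apply: inj_card_bij => //; rewrite -(card_codom g_inj); apply/subset_leq_card/subsetP=> y _.
  by have [i <-] := g_surj y; apply: codom_f.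
exists (size c) => //; exists f; first by exists g.
move=> x y; rewrite -[in RHS](gK x) -[in RHS](gK y).
move: (f x) (f y) => i j.
have /setP/(_ (g j)) := nbrs i; rewrite !inE => ->.
rewrite !(inj_eq g_inj) -[LHS]/((i != j) && ((j == ordS i) || (i == ordS j))).
rewrite -(can2_eq (@ordSK _) (@ord_predK _)) [ordS j == i]eq_sym.
have [->|//] := eqVneq i j.
have /negPf ne : j != ordS j by apply: contraTneq (adjS j) => <-; rewrite adj_irrefl.
by rewrite ne.
Qed.

(** * Induction on the size of the matching *)

Lemma k_connected_connect k (G : sgraph) : 0 < k -> k_connected k G ->
  forall x y : G, connect (@adj G) x y.
Proof.
move=> k_gt0 /andP[_ /forallP/(_ set0)]; rewrite cards0 k_gt0 setC0 => /forall_inP conn x y.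
have /forall_inP/(_ y (in_setT y)) := conn x (in_setT x).
by apply: connect_sub => u v /and3P[_ _ uv]; apply: connect1.
Qed.

(** The empty matching is enlarged step by step; 2m <= |G| leaves two uncovered vertices at every
    stage. *)
Lemma removable_matchings (k m : nat) (G : sgraph) :
    0 < k -> k_connected k G -> (forall x : G, k < degree x) ->
    (forall x : G, 2 * m - 2 <= degree x) -> 2 * m <= #|G| ->
    ~ ((k, m) = (1, 2) /\ is_cycle G) ->
  forall j, j <= m -> exists2 M : {set {set G}}, k_removable k M & #|M| = j.
Proof.
move=> k_gt0 conn deg_k deg_m cG ncyc; elim=> [|j IHj] lejm.
  exists set0; last by rewrite cards0.
  rewrite /k_removable /matching sub0set /=; apply/andP; split.
    by apply/trivIsetP=> A B; rewrite inE.
  apply/negPn/negP=> nconn; have /andP[ltk _] := conn.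
  have [A [B [x [y [xA yB dAB inD]]]]] := not_k_connected_del ltk nconn.
  rewrite ltnNge => /negP; apply.
  apply: (k_connected_bound conn xA yB dAB) => a b aA bB.
  by apply/negP=> /(inD a b aA bB); rewrite inE.
have [M /andP[mM connM] cM] := IHj (ltnW lejm).
have [/existsP[M' /andP[remM' /eqP cM']]|/existsPn nex] :=
  boolP [exists M' : {set {set G}}, k_removable k M' && (#|M'| == j.+1)].
  by exists M'.
have max (M' : {set {set G}}) : k_removable k M' -> #|M'| != #|M|.+1.
  by move=> remM'; have := nex M'; rewrite remM' cM.
have [||k1 j1 deg_le2] := larger_removable_matching k_gt0 mM connM deg_k _ max.
- by move=> x; apply: leq_trans (deg_m x); rewrite cM; move: lejm; clear; lia.
- by rewrite cM; move: lejm cG; clear; lia.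
have deg2 (x : G) : degree x = 2 by apply/eqP; rewrite eqn_leq deg_le2; have := deg_k x; rewrite k1.
have G_gt0 : 0 < #|G| by move: cG lejm; clear; lia.
have [x _] : exists x : G, x \in G by apply/card_gt0P.
case: ncyc; split; last exact: is_cycle_of_degree2 G_gt0 deg2 (k_connected_connect k_gt0 conn).
(* 2m - 2 <= 2 bounds m from above, and 1 = j < m from below. *)
congr (_, _) => //; have := deg_m x; rewrite deg2; move: lejm; rewrite -cM j1; clear; lia.
Qed.

Theorem theorem1p3 (k m : nat) (k_gt0 : 0 < k) (m_gt0 : 0 < m) (G : sgraph)
    (G_conn : k_connected k G)
    (G_deg : maxn k.+1 (2 * m - 2) <= min_degree G)
    (G_not_complete : ~ graph_iso G (complete_graph (2 * m - 1)))
    (G_not_cycle : ~ ((k, m) = (1, 2) /\ is_cycle G)) :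
  exists2 M : {set {set G}}, k_removable k M & #|M| = m.
Proof.
have deg_k (x : G) : k < degree x.
  by apply: leq_trans (min_degree_le x); apply: leq_trans G_deg; apply: leq_maxl.
have deg_m (x : G) : 2 * m - 2 <= degree x.
  by apply: leq_trans (min_degree_le x); apply: leq_trans G_deg; apply: leq_maxr.
apply: (removable_matchings k_gt0 G_conn) => //.
(* With fewer than 2m vertices, minimum degree 2m - 2 forces exactly 2m - 1 vertices and all
   edges. *)
rewrite leqNgt; apply/negP=> ltG; apply: G_not_complete.
have /card_gt0P[x _] : 0 < #|G| by apply: leq_ltn_trans (leq0n k) _; case/andP: G_conn.
have := leq_ltn_trans (deg_m x) (degree_lt_card x); move=> gtG.
apply: complete_graph_iso => [|y]; first by move: gtG ltG m_gt0; clear; lia.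
by apply: leq_trans (deg_m y); clear; lia.
Qed.
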